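(* Let $a$ be a nonzero real number and $n$ a positive integer. Then, with $i=\sqrt{-1}$, $$\sum_{k=1}^{\lfloor n/4\rfloor}\binom n{4k}E_{n-4k,a}(x)\big(2(1-a)+a(-4)^k\big)=\frac12\big((x+i)^n+(x-i)^n\big)+\frac{1-a}{a}x^n-\frac1aE_{n,a}(x).$$
   Context: For a real number $a$, the sequence $\{E_{n,a}\}$ is defined by $E_{0,a}=1$ and $E_{n,a}=-a\sum_{k=1}^{\lfloor n/2\rfloor}\binom{n}{2k}E_{n-2k,a}$ for $n\ge 1$, and the polynomials $E_{n,a}(x)$ are defined by $E_{n,a}(x)=\sum_{k=0}^n\binom nk E_{k,a}x^{n-k}$ for $n\ge 0$. *)

(* Defs.v *)
From mathcomp Require Import all_boot all_order all_algebra.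
From mathcomp Require Import reals.
From mathcomp Require Export complex.

Set Implicit Arguments.
Unset Strict Implicit.
Unset Printing Implicit Defensive.

Import GRing.Theory.

Local Open Scope ring_scope.

(* The recurrence for E_{n,a} is course-of-values, so the initial segment
   [E_{0,a}; ...; E_{n,a}] is computed by structural recursion on n; the
   defining equations are recovered in [Enum0] and [Enum_rec]. *)
Fixpoint Etable (R : realType) (a : R) (n : nat) : seq R :=
  if n is m.+1 then
    let s := Etable a m in
    rcons s (- a * \sum_(1 <= k < (n %/ 2).+1)
                     'C(n, 2 * k)%:R * s`_(n - 2 * k))
  else [:: 1].

Definition Enum (R : realType) (a : R) (n : nat) : R := (Etable a n)`_n.

Definition Epoly (R : realType) (a : R) (n : nat) : {poly R} :=
  \sum_(0 <= k < n.+1) ('C(n, k)%:R * Enum a k) *: 'X^(n - k).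

Lemma size_Etable (R : realType) (a : R) (n : nat) : size (Etable a n) = n.+1.
Proof. by elim: n => //= n IHn; rewrite size_rcons IHn. Qed.

Lemma nth_Etable (R : realType) (a : R) (m n : nat) :
  (m <= n)%N -> (Etable a n)`_m = Enum a m.
Proof.
elim: n => [|n IHn]; first by rewrite leqn0 => /eqP ->.
rewrite leq_eqVlt => /predU1P[-> //|]; rewrite ltnS => le_mn.
by rewrite /= nth_rcons size_Etable ltnS le_mn IHn.
Qed.

Lemma Enum0 (R : realType) (a : R) : Enum a 0 = 1.
Proof. by []. Qed.

Lemma Enum_rec (R : realType) (a : R) (n : nat) : (0 < n)%N ->
  Enum a n =
    - a * \sum_(1 <= k < (n %/ 2).+1) 'C(n, 2 * k)%:R * Enum a (n - 2 * k).
Proof.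
case: n => // n _.
rewrite {1}/Enum [Etable _ _]/= nth_rcons size_Etable ltnn eqxx.
congr (_ * _); apply: eq_big_nat => k /andP[k_gt0 _].
rewrite nth_Etable // leq_subLR -addn1 addnC leq_add2r.
by rewrite muln_gt0.
Qed.

(* Coefficients are mapped from R to R[i], so that the polynomials E_{n,a}
   can be evaluated at complex points. *)
Definition Eeval (R : realType) (a : R) (n : nat) (x : R[i]) : R[i] :=
  (map_poly (real_complex R) (Epoly a n)).[x].

(* Main.v *)
(** The generating function of E_{n,a}(x) is e^{xt} / (1 - a + a cosh t), so
    x^n = (1 - a) E_n(x) + (a/2) (E_n(x+1) + E_n(x-1)), and the identity
    amounts to
      (1 - a)(cosh t + cos t) + a cosh t cos t
        = \sum_k (2(1 - a) + a (-4)^k) t^(4k) / (4k)!.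
    Concretely, every power on the right-hand side is written in terms of
    E_n(x + y) with y in {0, 1, -1, i, -i, 1+i, 1-i, -1+i, -1-i}; expanding by
    E_n(x + y) = \sum_k C(n,k) E_{n-k}(x) y^k leaves a comparison of the power
    sums of these nine points, which vanish unless 4 divides k because
    (1 +- i)^4 = (-1 +- i)^4 = -4. *)
Require Import Defs.
From mathcomp Require Import all_boot all_order all_algebra.
From mathcomp Require Import reals.
From mathcomp Require Import ring.

Import GRing.Theory Num.Theory.

Local Open Scope ring_scope.
Local Open Scope complex_scope.

(** Both sides are the trinomial coefficient [n! / (k! j! (n - k - j)!)], symmetric in [k] and [j];
    both vanish when [k + j > n]. *)
Lemma mul_binBC (n k j : nat) :
  ('C(n, k) * 'C(n - k, j) = 'C(n, j) * 'C(n - j, k))%N.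
Proof.
have [le_kjn|lt_nkj] := leqP (k + j) n; last first.
  have small i l : (n < i + l)%N -> ('C(n, i) * 'C(n - i, l) = 0)%N.
    move=> lt_n; have [lt_ni|le_in] := ltnP n i; first by rewrite bin_small.
    by rewrite [X in (_ * X)%N]bin_small ?muln0 // ltn_subLR.
  by rewrite !small // addnC.
have fact3 i l : (i + l <= n)%N ->
    ('C(n, i) * 'C(n - i, l) * (i`! * l`! * (n - (i + l))`!) = n`!)%N.
  move=> le_n; have le_in : (i <= n)%N := leq_trans (leq_addr _ _) le_n.
  have le_ln : (l <= n - i)%N by rewrite leq_subRL.
  by rewrite -(bin_fact le_in) -(bin_fact le_ln) subnDA; ring.
apply/eqP; rewrite -(eqn_pmul2r (m := (k`! * j`! * (n - (k + j))`!)%N));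
  last by rewrite !muln_gt0 !fact_gt0.
by rewrite fact3 // (mulnC k`!) (addnC k) fact3 // addnC.
Qed.

Lemma big_ord_dvdn (V : nmodType) (d m : nat) (F : nat -> V) : (0 < d)%N ->
  \sum_(k < m.+1 | (d %| k)%N) F k = \sum_(j < (m %/ d).+1) F (d * j)%N.
Proof.
move=> d_gt0; elim: m => [|m IHm].
  by rewrite div0n big_mkcond !big_ord_recl !big_ord0 /= dvdn0 muln0.
rewrite big_mkcond big_ord_recr -big_mkcond /= IHm divnS //.
case: ifP => [d_dvd|_]; last by rewrite addr0.
rewrite add1n [RHS]big_ord_recr /=; congr (_ + F _).
by have := divnK d_dvd; rewrite divnS // d_dvd add1n mulnC.
Qed.

Definition appell (K : comNzRingType) (e : nat -> K) (n : nat) (x : K) : K :=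
  \sum_(k < n.+1) 'C(n, k)%:R * e k * x ^+ (n - k).

Lemma appellD (K : comNzRingType) (e : nat -> K) (n : nat) (x y : K) :
  appell K e n (x + y)
  = \sum_(k < n.+1) 'C(n, k)%:R * appell K e (n - k) x * y ^+ k.
Proof.
pose T (k j : nat) : K :=
  'C(n, k)%:R * 'C(n - k, j)%:R * e k * x ^+ (n - k - j) * y ^+ j.
transitivity (\sum_(k < n.+1) \sum_(j < n.+1) T k j).
  apply: eq_bigr => k _; rewrite exprDn mulr_sumr.
  (* The inner range depends on [k]; padding it to [n.+1] with terms whose binomial is zero makes
     the two sums exchangeable. *)
  rewrite (big_ord_widen n.+1 (fun j => 'C(n, k)%:R * e k *
    (x ^+ (n - k - j) * y ^+ j *+ 'C(n - k, j)))) ?ltnS ?leq_subr //.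
  rewrite big_mkcond; apply: eq_bigr => j _; rewrite /T ltnS.
  case: leqP => [_|lt_j]; first by rewrite -mulr_natl; ring.
  by rewrite [X in _ * X%:R]bin_small // mulr0n mulr0 !mul0r.
rewrite exchange_big; apply: eq_bigr => j _.
rewrite /appell mulr_sumr mulr_suml.
rewrite (big_ord_widen n.+1 (fun k => 'C(n, j)%:R *
    ('C(n - j, k)%:R * e k * x ^+ (n - j - k)) * y ^+ j)) ?ltnS ?leq_subr //.
rewrite [RHS]big_mkcond; apply: eq_bigr => k _.
rewrite /T -natrM mul_binBC natrM ltnS -!subnDA (addnC k).
case: leqP => [_|lt_k]; first by ring.
by rewrite [X in _ * X%:R]bin_small // mulr0n mulr0 !mul0r.
Qed.

Section EevalTheory.

Variables (R : realType) (a : R).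

Let e (k : nat) : R[i] := (Enum a k)%:C.

Lemma EevalE (n : nat) (x : R[i]) : Eeval a n x = appell _ e n x.
Proof.
rewrite /Eeval /Epoly big_mkord rmorph_sum horner_sum; apply: eq_bigr => k _.
by rewrite /= map_polyZ map_polyXn hornerZ hornerXn rmorphM rmorph_nat.
Qed.

Lemma EevalD (n : nat) (x y : R[i]) :
  Eeval a n (x + y) = \sum_(k < n.+1) 'C(n, k)%:R * Eeval a (n - k) x * y ^+ k.
Proof. by rewrite EevalE appellD; apply: eq_bigr => k _; rewrite EevalE. Qed.

Lemma Eeval_at0 (n : nat) : Eeval a n 0 = e n.
Proof.
rewrite EevalE /appell big_ord_recr /= big1 ?add0r => [|k _].
  by rewrite subnn binn mulr1 mul1r.
by rewrite expr0n subn_eq0 leqNgt ltn_ord mulr0.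
Qed.

(** Coefficient form of [(1 - a + a cosh t) * (\sum_n E_n t^n / n!) = 1], which is the defining
    recurrence. *)
Lemma Eeval_cosh_at0 (n : nat) :
  (1 - a%:C) * Eeval a n 0 + a%:C / 2 * (Eeval a n 1 + Eeval a n (-1))
  = (n == 0%N)%:R.
Proof.
(* Expanding about 0 at the points 1 and -1, odd powers cancel and even ones double. *)
have -> : Eeval a n 1 + Eeval a n (-1)
    = 2 * \sum_(k < (n %/ 2).+1) 'C(n, 2 * k)%:R * e (n - 2 * k)%N.
  rewrite -(big_ord_dvdn _ _ n (fun k => 'C(n, k)%:R * e (n - k)%N)) //.
  rewrite -[X in Eeval a n X + _]add0r -[X in _ + Eeval a n X]add0r.
  rewrite !EevalD -big_split mulr_sumr /= [RHS]big_mkcond.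
  apply: eq_bigr => k _; rewrite Eeval_at0 expr1n -signr_odd dvdn2.
  by case: (odd k); rewrite /= ?expr1 ?expr0; ring.
rewrite big_ord_recl muln0 subn0 bin0 mul1r Eeval_at0.
case: (posnP n) => [->|n_gt0].
  by rewrite div0n big_ord0 /e Enum0 /=; field.
have rec : e n = - a%:C *
    \sum_(i < n %/ 2) 'C(n, 2 * lift ord0 i)%:R * e (n - 2 * lift ord0 i)%N.
  rewrite {1}/e Enum_rec // rmorphM rmorphN rmorph_sum big_add1 big_mkord.
  by congr (_ * _); apply: eq_bigr => k _; rewrite rmorphM rmorph_nat.
by rewrite {1 2}rec /=; field.
Qed.

(** Expanded in powers of [x] around 0, 1 and -1, the right-hand side has as coefficient of [x ^+ k]
    a binomial times the combination at 0 in degree [n - k], so only [k = n] survives. *)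
Lemma expr_Eeval (n : nat) (x : R[i]) :
  x ^+ n
  = (1 - a%:C) * Eeval a n x
    + a%:C / 2 * (Eeval a n (x + 1) + Eeval a n (x - 1)).
Proof.
rewrite -{2}[x]add0r (addrC x 1) (addrC x (- 1)) !EevalD.
rewrite -big_split /= !mulr_sumr -big_split /=.
rewrite (eq_bigr (fun k : 'I_n.+1 =>
  'C(n, k)%:R * ((n - k)%N == 0%N)%:R * x ^+ k)) => [|k _]; last first.
  by rewrite -Eeval_cosh_at0; ring.
rewrite big_ord_recr /= big1 ?add0r => [|k _].
  by rewrite subnn binn !mul1r.
by rewrite subn_eq0 leqNgt ltn_ord mulr0 mul0r.
Qed.

Lemma power_sum4 (k : nat) :
  (1 - a%:C) / 2 * (1 + (-1) ^+ k + 'i%C ^+ k + (- 'i%C) ^+ k)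
  + a%:C / 4 * ((1 + 'i%C) ^+ k + (1 - 'i%C) ^+ k
                + (-1 + 'i%C) ^+ k + (-1 - 'i%C) ^+ k)
  = if (4 %| k)%N then 2 * (1 - a%:C) + a%:C * (- 4) ^+ (k %/ 4) else 0 :> R[i].
Proof.
have i2 : 'i%C * 'i%C = -1 :> R[i] by rewrite -expr2 sqr_i.
have i4 : 'i%C ^+ 4 = 1 :> R[i] by ring: i2.
have Ni4 : (- 'i%C) ^+ 4 = 1 :> R[i] by ring: i2.
have N14 : (-1) ^+ 4 = 1 :> R[i] by ring.
have p1 : (1 + 'i%C) ^+ 4 = - 4 :> R[i] by ring: i2.
have p2 : (1 - 'i%C) ^+ 4 = - 4 :> R[i] by ring: i2.
have p3 : (-1 + 'i%C) ^+ 4 = - 4 :> R[i] by ring: i2.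
have p4 : (-1 - 'i%C) ^+ 4 = - 4 :> R[i] by ring: i2.
(* All eight points have fourth power 1 or -4, so only the residue of [k] modulo 4 remains to be
   examined. *)
have red (z : R[i]) : z ^+ k = (z ^+ 4) ^+ (k %/ 4) * z ^+ (k %% 4).
  by rewrite {1}(divn_eq k 4) mulnC exprD exprM.
rewrite (red (-1)) (red 'i%C) (red (- 'i%C)) (red (1 + 'i%C)) (red (1 - 'i%C)).
rewrite (red (-1 + 'i%C)) (red (-1 - 'i%C)).
rewrite i4 Ni4 N14 p1 p2 p3 p4 !expr1n !mul1r /dvdn.
set u := (- 4) ^+ _.
have : (k %% 4 < 4)%N by rewrite ltn_mod.
case: (k %% 4)%N => [|[|[|[|//]]]] _ /=; rewrite ?expr0 ?expr1.
- by field.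
- by field.
- by field: i2.
- by field: i2.
Qed.

End EevalTheory.

Theorem theorem2p8 (R : realType) (a : R) (ha : a != 0)
    (n : nat) (hn : (0 < n)%N) (x : R[i]) :
  \sum_(1 <= k < (n %/ 4).+1)
     'C(n, 4 * k)%:R * Eeval a (n - 4 * k) x
       * (2 * (1 - a%:C) + a%:C * (- 4) ^+ k)
  = 1 / 2 * ((x + 'i%C) ^+ n + (x - 'i%C) ^+ n)
    + (1 - a%:C) / a%:C * x ^+ n - 1 / a%:C * Eeval a n x.
Proof.
have a_neq0 : a%:C != 0 by rewrite fmorph_eq0.
pose E y := Eeval a n (x + y).
pose w k : R[i] := 2 * (1 - a%:C) + a%:C * (- 4) ^+ k.
have sumE : \sum_(k < (n %/ 4).+1) 'C(n, 4 * k)%:R * Eeval a (n - 4 * k) x * w k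
  = (1 - a%:C) / 2 * (E 1 + E (-1) + E 'i%C + E (- 'i%C))
  + a%:C / 4 * (E (1 + 'i%C) + E (1 - 'i%C) + E (-1 + 'i%C) + E (-1 - 'i%C)).
  (* Writing [k] as [4 * k %/ 4] makes the summand a function of [4 * k], as [big_ord_dvdn]
     requires. *)
  under eq_bigr => k _ do rewrite -{3}(mulKn k (isT : 0 < 4)%N).
  rewrite -(big_ord_dvdn _ 4 n (fun k =>
    'C(n, k)%:R * Eeval a (n - k) x * w (k %/ 4)%N)) // /E !EevalD.
  rewrite -!big_split /= !mulr_sumr -big_split /= big_mkcond.
  apply: eq_bigr => k _; rewrite expr1n.
  have := power_sum4 _ a k; case: ifP => _ ps; first by rewrite /w -ps; ring.
  rewrite -[LHS](mulr0 ('C(n, k)%:R * Eeval a (n - k) x)) -ps; ring.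
rewrite big_add1 big_mkord /=.
(* The theorem sums from [k = 1], so the term [E_n(x) * w 0] moves to the right. *)
move: sumE; rewrite big_ord_recl muln0 subn0 bin0 mul1r.
move=> /(canRL (addKr _)) ->.
(* The coefficients of [E_n(x)] agree because [((1 - a)^2 - 1) / a = a - 2 = - w 0]. *)
rewrite !(expr_Eeval _ a) /E.
rewrite (_ : x + (1 + 'i%C) = x + 'i%C + 1); last by ring.
rewrite (_ : x + (1 - 'i%C) = x - 'i%C + 1); last by ring.
rewrite (_ : x + (-1 + 'i%C) = x + 'i%C - 1); last by ring.
rewrite (_ : x + (-1 - 'i%C) = x - 'i%C - 1); last by ring.
by rewrite /w expr0; field; rewrite a_neq0.
Qed.
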